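(* Let $k\ge 0$ be an integer and let $\{\mathbf{M}_j\}_{j=0}^{k}$ be a set of sequentially dominated HPD matrices, i.e. there is a constant $C>0$ with $\mathbf{M}_j\le C\mathbf{M}_{j-1}$ for every $j=1,\dots,k$. Assume that for every $j=0,\dots,k$ the multiplication operator $\mathcal{D}_j: p(z)\mapsto zp(z)$ is bounded on $(\mathbb{P}[z],\langle\cdot,\cdot\rangle_{\mathbf{M}_j})$. Consider the matrix Sobolev inner product on $\mathbb{P}[z]$ $$\langle p,q\rangle_{\mathbf{M}_S}=\sum_{j=0}^{k}\langle p^{(j)},q^{(j)}\rangle_{\mathbf{M}_j}.$$ Then the multiplication operator $p(z)\mapsto zp(z)$ is bounded on $(\mathbb{P}[z],\langle\cdot,\cdot\rangle_{\mathbf{M}_S})$.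
   Context: $\mathbb{P}[z]$ is the space of polynomials in $z$ with complex coefficients, and $p^{(j)}$ is the $j$-th derivative of $p$. $c_{00}$ is the space of complex sequences (row vectors) with finitely many nonzero entries. An infinite Hermitian matrix $\mathbf{M}=(c_{i,j})_{i,j=0}^{\infty}$ (i.e. $c_{i,j}=\overline{c_{j,i}}$) is HPD (Hermitian positive definite) if all its finite truncated sections are positive definite, equivalently $v\mathbf{M}v^*>0$ for all $0\ne v\in c_{00}$. An HPD matrix defines an inner product on $\mathbb{P}[z]$ by $\langle p,q\rangle_{\mathbf{M}}=v\mathbf{M}w^*$ where $p(z)=\sum_n v_nz^n$, $q(z)=\sum_n w_nz^n$, with norm $\|p\|_{\mathbf{M}}^2=\langle p,p\rangle_{\mathbf{M}}$. For infinite Hermitian matrices, $\mathbf{B}\le\mathbf{A}$ means $v\mathbf{B}v^*\le v\mathbf{A}v^*$ for every $v\in c_{00}$. A linear operator on $\mathbb{P}[z]$ is bounded with respect to an inner product if its operator norm for the associated norm is finite. *)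

(* Defs.v *)
From mathcomp Require Import all_boot all_order all_algebra.
From mathcomp Require Import all_classical all_reals ereal.
From mathcomp Require Export complex.

Set Implicit Arguments.
Unset Strict Implicit.
Unset Printing Implicit Defensive.

Import Order.TTheory GRing.Theory Num.Theory.
Local Open Scope classical_set_scope.
Local Open Scope ring_scope.

Section Defs.
Variable R : realType.
Local Notation C := R[i].

Definition infmx := nat -> nat -> C.

Definition scale_infmx (a : C) (M : infmx) : infmx := fun i j => a * M i j.

Definition c00 : set (nat -> C) := [set v | finite_set [set n | v n != 0]].

(* The scalar v M w^*.  The sums over nat are sums over the (finite) support
   of the summand, hence have their intended meaning for v and w in c00. *)
Definition mxform (M : infmx) (v w : nat -> C) : C :=
  \sum_(i \in [set: nat]) \sum_(j \in [set: nat]) v i * M i j * (w j)^*.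

Definition hermitian_infmx (M : infmx) : Prop := forall i j, M i j = (M j i)^*.

Definition section_mx (M : infmx) (n : nat) : 'M[C]_n := \matrix_(i, j) M i j.

(* The order of R[i] only compares numbers with equal imaginary parts, so
   0 < z says that z is real and positive. *)
Definition posdefmx (n : nat) (A : 'M[C]_n) : Prop :=
  forall v : 'rV[C]_n, v != 0 -> 0 < (v *m A *m map_mx Num.conj v^T) 0 0.

Definition HPD (M : infmx) : Prop :=
  hermitian_infmx M /\ forall n, posdefmx (section_mx M n).

Definition le_infmx (B A : infmx) : Prop :=
  forall v, c00 v -> mxform B v v <= mxform A v v.

Definition seq_dominated (k : nat) (M : nat -> infmx) : Prop :=
  exists2 a : R, 0 < a &
    forall j, (1 <= j <= k)%N ->
      le_infmx (M j) (scale_infmx (real_complex R a) (M j.-1)).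

Definition ip (M : infmx) (p q : {poly C}) : C :=
  mxform M (fun n => p`_n) (fun n => q`_n).

Definition sobolev_ip (k : nat) (M : nat -> infmx) (p q : {poly C}) : C :=
  \sum_(j < k.+1) ip (M j) p^`(j) q^`(j).

(* For an inner product s, s p p is a nonnegative real, which Re extracts; it is
   positive for p != 0, so the quotients in op_norm are genuine. *)
Definition ip_norm (s : {poly C} -> {poly C} -> C) (p : {poly C}) : R :=
  Num.sqrt (complex.Re (s p p)).

Definition op_norm (s : {poly C} -> {poly C} -> C)
    (T : {linear {poly C} -> {poly C}}) : \bar R :=
  ereal_sup [set (ip_norm s (T p) / ip_norm s p)%:E | p in [set p | p != 0]].

Definition bounded_op (s : {poly C} -> {poly C} -> C)
    (T : {linear {poly C} -> {poly C}}) : Prop :=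
  (op_norm s T < +oo)%E.

Definition mulX : {linear {poly C} -> {poly C}} := 'X \*o idfun.

End Defs.

(* Main.v *)
(* By Leibniz, (z p)^(j) = z p^(j) + j p^(j-1).  The parallelogram law bounds
   the squared M_j-norm of the right-hand side by
   2 |z p^(j)|_j^2 + 2 j^2 |p^(j-1)|_j^2; boundedness of multiplication for M_j
   controls the first term by |p^(j)|_j^2, and M_j <= C M_(j-1) controls the
   second one by |p^(j-1)|_(j-1)^2, both of which are terms of the Sobolev
   norm of p. *)
Require Import Defs.
From mathcomp Require Import all_boot all_order all_algebra.
From mathcomp Require Import all_classical all_reals ereal.
From mathcomp Require Import ring.

Set Implicit Arguments.
Unset Strict Implicit.
Unset Printing Implicit Defensive.

Import Order.TTheory GRing.Theory Num.Theory.
Local Open Scope classical_set_scope.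
Local Open Scope ring_scope.

Section InnerProduct.
Variable R : realType.
Local Notation C := R[i].
Local Notation "x %:C" := (real_complex R x).

(** Summands with an index outside [I_n] vanish. Any common bound [n] on the supports is allowed, so
    that forms of several polynomials can be compared term by term over one range. *)
Lemma mxform_fin (M : infmx R) (v w : nat -> C) (n : nat) :
    (forall i, (n <= i)%N -> v i = 0) -> (forall i, (n <= i)%N -> w i = 0) ->
  mxform M v w = \sum_(i < n) \sum_(j < n) v i * M i j * (w j)^*.
Proof.
move=> v0 w0; rewrite (fsbig_ord _ n (fun i => \sum_(j < n) v i * M i j * (w j)^*)).
rewrite (@fsbig_widen _ _ _ _ _ setT)//.
  rewrite /mxform; apply: eq_fsbigr => i _.
  rewrite (fsbig_ord _ n (fun j => v i * M i j * (w j)^*)).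
  apply/esym/fsbig_widen => // j [_ /negP]; rewrite -leqNgt => nj.
  by rewrite /= w0// conjC0 mulr0.
move=> i [_ /negP]; rewrite -leqNgt => ni /=.
by apply: big1 => j _; rewrite v0// !mul0r.
Qed.

Lemma ip_fin (M : infmx R) (p q : {poly C}) (n : nat) :
    (size p <= n)%N -> (size q <= n)%N ->
  ip M p q = \sum_(i < n) \sum_(j < n) p`_i * M i j * (q`_j)^*.
Proof.
by move=> pn qn; apply: mxform_fin => i ni; rewrite nth_default// (leq_trans _ ni).
Qed.

Lemma ip_gt0 (M : infmx R) (p : {poly C}) : HPD M -> p != 0 -> 0 < ip M p p.
Proof.
move=> [_ /(_ (size p)) Mpos] p0; rewrite (@ip_fin _ _ _ (size p))//.
have /Mpos : \row_(i < size p) p`_i != 0.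
  (* A zero coefficient row would make the leading coefficient, its last entry, vanish. *)
  apply: contraNneq p0 => v0; rewrite -lead_coef_eq0 lead_coefE.
  have [sp0|p_gt0] := posnP (size p); first by rewrite nth_default ?sp0.
  have lt_p : ((size p).-1 < size p)%N by rewrite prednK.
  by move/rowP/(_ (Ordinal lt_p)) : v0; rewrite !mxE /= => ->.
congr (0 < _); rewrite mxE exchange_big /=; apply: eq_bigr => j _.
rewrite !mxE big_distrl /=; apply: eq_bigr => i _.
by rewrite !mxE.
Qed.

Lemma ip0 (M : infmx R) : ip M 0 0 = 0.
Proof. by rewrite (@ip_fin _ _ _ 0) ?size_poly0// big_ord0. Qed.

Lemma ip_ge0 (M : infmx R) (p : {poly C}) : HPD M -> 0 <= ip M p p.
Proof.
by move=> HM; have [->|/(ip_gt0 HM)/ltW//] := eqVneq p 0; rewrite ip0.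
Qed.

Lemma ip_parallelogram (M : infmx R) (p q : {poly C}) :
  ip M (p + q) (p + q) + ip M (p - q) (p - q) =
  2 * ip M p p + 2 * ip M q q.
Proof.
pose n := maxn (size p) (size q).
have pn : (size p <= n)%N by exact: leq_maxl.
have qn : (size q <= n)%N by exact: leq_maxr.
have pDq : (size (p + q)%R <= n)%N by exact: size_polyD.
have pBq : (size (p - q)%R <= n)%N.
  by apply: (leq_trans (size_polyD _ _)); rewrite size_polyN.
rewrite !(@ip_fin _ _ _ n)// !mulr_sumr -!big_split /=; apply: eq_bigr => i _.
rewrite !mulr_sumr -!big_split /=; apply: eq_bigr => j _.
by rewrite !coefD !coefN rmorphB rmorphD; ring.
Qed.

(** Drops the nonnegative term of [p - q] from the parallelogram law; this replaces the triangle
    inequality at the level of squared norms. *)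
Lemma ip_add_le (M : infmx R) (p q : {poly C}) : HPD M ->
  ip M (p + q) (p + q) <= 2 * ip M p p + 2 * ip M q q.
Proof.
by move=> HM; rewrite -ip_parallelogram lerDl ip_ge0.
Qed.

Lemma ip_mulrn (M : infmx R) (p : {poly C}) (m : nat) :
  ip M (p *+ m) (p *+ m) = (m ^ 2)%:R * ip M p p.
Proof.
have pn : (size (p *+ m)%R <= size p)%N.
  by rewrite -scaler_nat size_scale_leq.
rewrite !(@ip_fin _ _ _ (size p))// mulr_sumr; apply: eq_bigr => i _.
rewrite mulr_sumr; apply: eq_bigr => j _.
by rewrite !coefMn rmorphMn /= natrX -(mulr_natl p`_i) -(mulr_natl (p`_j)^*); ring.
Qed.

Lemma ip_dominated (A B : infmx R) (a : C) (p : {poly C}) :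
  le_infmx B (scale_infmx a A) -> ip B p p <= a * ip A p p.
Proof.
move=> /(_ (fun n => p`_n)) BA.
suff -> : a * ip A p p = ip (scale_infmx a A) p p.
  apply: BA; apply: (@sub_finite_set _ _ `I_(size p)) => // n /=.
  by apply: contraNltn => /(nth_default 0) ->.
rewrite !(@ip_fin _ _ _ (size p))// mulr_sumr; apply: eq_bigr => i _.
rewrite mulr_sumr; apply: eq_bigr => j _.
by rewrite /scale_infmx; ring.
Qed.

(** Trades the extended-real supremum of quotients of square roots for an inequality between squared
    norms, which can be summed over [j]. *)
Lemma bounded_opP (s : {poly C} -> {poly C} -> C)
    (T : {linear {poly C} -> {poly C}}) :
    (forall p, p != 0 -> 0 < s p p) -> (forall p, 0 <= s p p) ->
  bounded_op s T <->
  exists2 c : R, 0 <= c & forall p, p != 0 -> s (T p) (T p) <= c%:C * s p p.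
Proof.
move=> s_gt0 s_ge0.
have sE p : s p p = (complex.Re (s p p))%:C by rewrite RRe_real// ger0_real.
have Re_ge0 p : 0 <= complex.Re (s p p) by rewrite -ler0c -sE.
have Re_gt0 p : p != 0 -> 0 < complex.Re (s p p).
  by move=> p0; rewrite -ltcR -sE s_gt0.
rewrite /bounded_op /op_norm; split=> [|[c c0 bT]].
  (* The constant is the square of the operator norm. *)
  set N := ereal_sup _ => N_lty; exists (fine N ^+ 2); first exact: sqr_ge0.
  move=> p p0; rewrite [s (T p) _]sE [s p p]sE -rmorphM lecR.
  have : ((ip_norm s (T p) / ip_norm s p)%:E <= N)%E.
    by apply: ereal_sup_ubound; exists p.
  (* [N] is finite: [+oo] is excluded by boundedness, and [-oo] by the quotient at [p] lying below
     [N]. *)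
  case: N N_lty => [r| |]//= _; rewrite lee_fin ler_pdivrMr ?sqrtr_gt0 ?Re_gt0//.
  move=> le_r; have rhs_ge0 := le_trans (sqrtr_ge0 _) le_r.
  have := lerXn2r 2 (sqrtr_ge0 _) rhs_ge0 le_r.
  by rewrite exprMn !sqr_sqrtr.
apply: (@le_lt_trans _ _ (Num.sqrt c)%:E); last exact: ltry.
apply: ge_ereal_sup => _ [p p0 <-]; rewrite lee_fin.
rewrite ler_pdivrMr ?sqrtr_gt0 ?Re_gt0// -sqrtrM// ler_wsqrtr//.
by rewrite -lecR rmorphM /= -!sE; exact: bT.
Qed.

(** Leibniz rule, in which only the first derivative of ['X] contributes. For [j = 0] the
    meaningless index [j.-1] is harmless, since its term has multiplicity 0. *)
Lemma derivn_mulX (p : {poly C}) (j : nat) :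
  (mulX R p)^`(j) = mulX R p^`(j) + p^`(j.-1) *+ j.
Proof.
have -> : mulX R p = p * 'X + 0%:P by rewrite addr0 /= mulrC.
have -> : mulX R p^`(j) = p^`(j) * 'X by rewrite /= mulrC.
case: j => [|j]; last by rewrite derivnMXaddC addrC.
by rewrite !derivn0 mulr0n !addr0.
Qed.

Lemma sobolev_ip_ge_term (k : nat) (M : nat -> infmx R) (p : {poly C}) (j : nat) :
    (forall i, (i <= k)%N -> HPD (M i)) -> (j <= k)%N ->
  ip (M j) p^`(j) p^`(j) <= sobolev_ip k M p p.
Proof.
move=> HM; rewrite -ltnS => jk.
rewrite /sobolev_ip (bigD1 (Ordinal jk))//= lerDl sumr_ge0// => i _.
by apply/ip_ge0/HM; rewrite -ltnS.
Qed.

End InnerProduct.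

Theorem theorem1 (R : realType) (k : nat) (M : nat -> infmx R)
    (HM : forall j, (j <= k)%N -> HPD (M j))
    (Hdom : seq_dominated k M)
    (Hbdd : forall j, (j <= k)%N -> bounded_op (ip (M j)) (mulX R)) :
  bounded_op (sobolev_ip k M) (mulX R).
Proof.
have term_ge0 j q : (j <= k)%N -> 0 <= ip (M j) q q.
  by move=> jk; apply/ip_ge0/HM.
have S_ge0 p : 0 <= sobolev_ip k M p p.
  by apply: sumr_ge0 => j _; apply: term_ge0; rewrite -ltnS.
have S_gt0 p : p != 0 -> 0 < sobolev_ip k M p p.
  move=> p0; apply: lt_le_trans (sobolev_ip_ge_term p HM (leq0n k)).
  by apply/ip_gt0/p0/HM.
have [a a0 dom] := Hdom.
have bound_j (j : 'I_k.+1) : exists b : R, 0 <= b /\ forall p, 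
    ip (M j) (mulX R p)^`(j) (mulX R p)^`(j) <=
    real_complex R b * sobolev_ip k M p p.
  have jk : (j <= k)%N by rewrite -ltnS.
  have [c c0 Hc] := (bounded_opP (mulX R) (fun p => ip_gt0 (HM j jk))
    (fun p => ip_ge0 p (HM j jk))).1 (Hbdd j jk).
  (* Both factors 2 come from [ip_add_le], [c] bounds multiplication for [M j], [j ^ 2] is the
     squared Leibniz coefficient, and [a] is the domination constant. *)
  exists (2 * c + 2 * ((j ^ 2)%:R * a)); split.
    by rewrite addr_ge0// !mulr_ge0// ltW.
  move=> p; rewrite derivn_mulX.
  apply: le_trans (ip_add_le _ _ (HM j jk)) _.
  set S := sobolev_ip k M p p.
  have -> : real_complex R (2 * c + 2 * ((j ^ 2)%:R * a)) * S =
      2 * (real_complex R c * S) + 2 * ((j ^ 2)%:R * (real_complex R a * S)).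
    by rewrite rmorphD !(rmorphM, rmorph_nat); ring.
  apply: lerD; apply: ler_wpM2l => //.
    have [->|/Hc pj] := eqVneq p^`(j) 0.
      by rewrite linear0 ip0; apply: mulr_ge0; rewrite ?ler0c ?S_ge0.
    by apply: le_trans pj _; apply: ler_wpM2l; rewrite ?ler0c ?sobolev_ip_ge_term.
  rewrite ip_mulrn.
  (* Domination starts at index 1; at index 0 the term carries the factor 0. *)
  case: (nat_of_ord j) jk => [|i] ik.
    by rewrite !mul0r.
  apply: ler_wpM2l => //.
  have /(ip_dominated p^`(i)) Mle := dom i.+1 ik.
  apply: le_trans Mle _; apply: ler_wpM2l; first by rewrite ler0c ltW.
  exact: sobolev_ip_ge_term HM (ltnW ik).
(* Each term is bounded by a multiple of the full Sobolev form, so the constants chosen for the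
   finitely many [j] simply add up. *)
have [b /all_and2[b0 Hb]] := fin_all_exists bound_j.
apply/(bounded_opP _ S_gt0 S_ge0); exists (\sum_j b j); first by rewrite sumr_ge0.
by move=> p _; rewrite rmorph_sum mulr_suml ler_sum.
Qed.
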